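(* Let $C\subset\mathbb{R}^n$ be a pointed, $n$-dimensional closed convex cone, $\Omega=S^{n-1}\cap\operatorname{int}C^{\circ}$, and $\omega\subset\Omega$ a nonempty compact set. Then there exist $K,L\in\mathcal{K}(C,\omega)$ such that $C_{\gamma^{n}}(K,\cdot)=C_{\gamma^{n}}(L,\cdot)$ but $K\neq L$.
   Context: $C^{\circ}=\{x:\langle x,y\rangle\le 0\ \forall y\in C\}$. A pseudo-cone is a nonempty closed convex set $K$ with $o\notin K$ and $\lambda K\subseteq K$ for $\lambda\ge1$; it is a $C$-pseudo-cone if its recession cone $\{z:K+z\subseteq K\}$ equals $C$. Support function $h_K(x)=\sup_{y\in K}\langle x,y\rangle$ on $C^{\circ}$, $\bar h_K=-h_K$. For $u\in\Omega$, $H_K^-(u)=\{x:\langle x,u\rangle\le h_K(u)\}$. $\mathcal{K}(C,\omega)$ is the set of $C$-pseudo-cones $K$ with $K=C\cap\bigcap_{u\in\omega}H^-_K(u)$. For Borel $\eta\subset\Omega$, $S_{\gamma^n}(K,\eta)=(2\pi)^{-n/2}\int_{\nu_K^{-1}(\eta)}e^{-|x|^2/2}d\mathcal{H}^{n-1}(x)$, where $\nu_K^{-1}(\eta)$ is the set of boundary points of $K$ with an outer unit normal in $\eta$, and $C_{\gamma^n}(K,\eta)=\int_\eta\bar h_K(u)\,dS_{\gamma^n}(K,u)$. *)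

(* Defs.v *)
From HB Require Import structures.
From mathcomp Require Import all_boot all_order all_algebra.
From mathcomp Require Import all_classical all_reals all_analysis.

Set Implicit Arguments.
Unset Strict Implicit.
Unset Printing Implicit Defensive.
Import Order.TTheory GRing.Theory Num.Theory.
Import numFieldNormedType.Exports.

Local Open Scope classical_set_scope.
Local Open Scope ring_scope.

Section Defs.
Variables (R : realType) (n : nat).
Local Notation V := 'rV[R]_n.

Definition dotv (x y : V) : R := \sum_(i < n) x ord0 i * y ord0 i.
Definition enorm (x : V) : R := Num.sqrt (dotv x x).

Definition Borel (A : set V) : Prop := <<s [set U : set V | open U] >> A.

Definition convex_set (A : set V) : Prop :=
  forall x y (t : R), A x -> A y -> 0 <= t <= 1 -> A ((1 - t) *: x + t *: y).

Definition closed_convex_cone (C : set V) : Prop :=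
  [/\ closed C, C 0, convex_set C & forall x (l : R), C x -> 0 <= l -> C (l *: x)].

Definition pointed (C : set V) : Prop :=
  forall x, C x -> C (- x) -> x = 0.

(** C is n-dimensional: its linear span is all of R^n
    (equivalently, some finite family of points of C spans R^n) *)
Definition full_dim (C : set V) : Prop :=
  exists s : seq V, (forall x, x \in s -> C x) /\ (span s = fullv)%VS.

Definition polar (C : set V) : set V := [set x | forall y, C y -> dotv x y <= 0].

Definition Omega (C : set V) : set V :=
  [set u | enorm u = 1 /\ interior (polar C) u].

(** support function (real-valued; finite on C° for nonempty K ⊆ C) *)
Definition supp (K : set V) (x : V) : R := sup [set dotv x y | y in K].
Definition supp_bar (K : set V) (x : V) : R := - supp K x.

Definition recession_cone (K : set V) : set V :=
  [set z | forall y, K y -> K (y + z)].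

Definition pseudo_cone (K : set V) : Prop :=
  [/\ K !=set0, closed K, convex_set K, ~ K 0 &
      forall x (l : R), K x -> 1 <= l -> K (l *: x)].

Definition C_pseudo_cone (C K : set V) : Prop :=
  pseudo_cone K /\ recession_cone K = C.

Definition halfspace (K : set V) (u : V) : set V :=
  [set x | dotv x u <= supp K u].

Definition Kclass (C omega : set V) : set (set V) :=
  [set K | C_pseudo_cone C K /\
           K = C `&` \bigcap_(u in omega) halfspace K u].

Definition outer_unit_normal (K : set V) (x u : V) : Prop :=
  enorm u = 1 /\ forall y, K y -> dotv y u <= dotv x u.

Definition rev_gauss_map (K eta : set V) : set V :=
  [set x | K x /\ ~ interior K x /\ exists2 u, eta u & outer_unit_normal K x u].

(** Hausdorff measure H^s on R^n (Euclidean metric), normalised so that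
    H^n = Lebesgue measure: H^s = lim_{delta->0} H^s_delta with
    H^s_delta(A) = inf { sum_i alpha_s (diam U_i / 2)^s : A ⊆ U_i, diam U_i <= delta } *)
Fixpoint unit_ball_vol (k : nat) : R :=
  match k with
  | 0%N => 1
  | 1%N => 2
  | k'.+2 => (2 * pi / k'.+2%:R) * unit_ball_vol k'
  end.

Definition diam (U : set V) : R := sup [set enorm (x - y) | x in U & y in U].

Definition haus_term (s : nat) (U : set V) : R :=
  if asbool (U = set0) then 0 else unit_ball_vol s * (diam U / 2) ^+ s.

Definition delta_cover (delta : R) (A : set V) (U : nat -> set V) : Prop :=
  A `<=` \bigcup_i U i /\
  forall i x y, U i x -> U i y -> enorm (x - y) <= delta.

Definition hausdorff_delta (s : nat) (delta : R) (A : set V) : \bar R :=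
  ereal_inf [set (\sum_(i <oo) (haus_term s (U i))%:E)%E | U in delta_cover delta A].

Definition hausdorff (s : nat) (A : set V) : \bar R :=
  ereal_sup [set hausdorff_delta s delta A | delta in [set d : R | 0 < d]].

(** Lebesgue integral of a nonnegative function f over a Borel set A w.r.t. a
    (Borel) measure mu, defined as the supremum of the integrals of Borel
    simple functions below f on A (lower Lebesgue sums) *)
Definition nonneg_integral (mu : set V -> \bar R) (A : set V) (f : V -> R) : \bar R :=
  ereal_sup [set z | exists (k : nat) (E : nat -> set V),
     [/\ (forall i, Borel (E i)), (forall i, E i `<=` A),
         (forall i j, (i < k)%N -> (j < k)%N -> i <> j -> E i `&` E j = set0) &
         z = (\sum_(i < k) (inf [set f x | x in E i])%:E * mu (E i))%E]].

Definition gauss_density (x : V) : R :=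
  (Num.sqrt (2 * pi) ^+ n)^-1 * expR (- (enorm x ^+ 2) / 2).

Definition S_gauss (K : set V) (eta : set V) : \bar R :=
  nonneg_integral (hausdorff n.-1) (rev_gauss_map K eta) gauss_density.

Definition C_gauss (K : set V) (eta : set V) : \bar R :=
  nonneg_integral (S_gauss K) eta (supp_bar K).

End Defs.

(* Main.v *)
Require Import Defs.
From HB Require Import structures.
From mathcomp Require Import all_boot all_order all_algebra.
From mathcomp Require Import all_classical all_reals all_analysis.
From mathcomp Require Import ring lra.
Import Order.TTheory GRing.Theory Num.Theory.
Import numFieldNormedType.Exports.
Local Open Scope classical_set_scope.
Local Open Scope ring_scope.

(** Fix [u] in [omega] and truncate the cone: [K_t = C ∩ {<x,u> <= -t}].
Every boundary point of [K_t] with a normal in [Omega C] lies on the face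
[F_t = C ∩ {<x,u> = -t}], and those having such a normal other than [u] lie in
the relative boundary of [F_t], which is [H^(n-1)]-null.  Hence [C_gauss K_t] is
an atom at [u], of mass a constant times
[t * ∫_(F_t) e^(-|x|²/2) = t^n * ∫_(F_1) e^(-t²|x|²/2)].  Up to the degenerate
cases where the last integral is [0] or infinite for all [t], this is a
continuous positive function of [t] that tends to [0] at [0] and at infinity,
so it takes the same value at two distinct parameters.

Measurability of the sets is never used: the relative boundary is null because
it has arbitrarily many similar, pairwise separated copies inside [F_t], and
the continuity in [t] follows from the bounds [1 <= |x| <= M] on [F_1], which
give exponential comparisons between the integrals. *)

(** * Euclidean norm on row vectors *)

Section Euclid.
Variables (R : realType) (n : nat).
Local Notation V := 'rV[R]_n.
Implicit Types (x y u v w : V) (a t r : R).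

Lemma dotvC x y : dotv x y = dotv y x.
Proof. by apply: eq_bigr => i _; rewrite mulrC. Qed.

Lemma dotvDl x y u : dotv (x + y) u = dotv x u + dotv y u.
Proof. by rewrite -big_split; apply: eq_bigr => i _; rewrite mxE mulrDl. Qed.

Lemma dotvZl a x u : dotv (a *: x) u = a * dotv x u.
Proof. by rewrite mulr_sumr; apply: eq_bigr => i _; rewrite mxE mulrA. Qed.

Lemma dotvDr x y u : dotv u (x + y) = dotv u x + dotv u y.
Proof. by rewrite dotvC dotvDl !(dotvC u). Qed.

Lemma dotvZr a x u : dotv u (a *: x) = a * dotv u x.
Proof. by rewrite dotvC dotvZl (dotvC u). Qed.

Lemma dotvNl x u : dotv (- x) u = - dotv x u.
Proof. by rewrite -scaleN1r dotvZl mulN1r. Qed.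

Lemma dotvNr x u : dotv u (- x) = - dotv u x.
Proof. by rewrite dotvC dotvNl dotvC. Qed.

Lemma dotv0l u : dotv 0 u = 0.
Proof. by rewrite -(scale0r u) dotvZl mul0r. Qed.

Definition dotvE := (dotvDl, dotvDr, dotvZl, dotvZr, dotvNl, dotvNr, dotv0l).

Lemma dotvv_ge0 x : 0 <= dotv x x.
Proof. by apply: sumr_ge0 => i _; rewrite -expr2 sqr_ge0. Qed.

Lemma enorm_ge0 x : 0 <= enorm x.
Proof. exact: sqrtr_ge0. Qed.

Lemma enorm_sq x : enorm x ^+ 2 = dotv x x.
Proof. by rewrite sqr_sqrtr ?dotvv_ge0. Qed.

Lemma enormZ a x : enorm (a *: x) = `|a| * enorm x.
Proof.
by rewrite /enorm dotvZl dotvZr mulrA -expr2 sqrtrM ?sqr_ge0// sqrtr_sqr.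
Qed.

Lemma enorm0 : enorm (0 : V) = 0.
Proof. by rewrite /enorm dotv0l sqrtr0. Qed.

Lemma enormN x : enorm (- x) = enorm x.
Proof. by rewrite -scaleN1r enormZ normrN1 mul1r. Qed.

Lemma coord_le_enorm x i : `|x ord0 i| <= enorm x.
Proof.
rewrite -sqrtr_sqr ler_wsqrtr// /dotv (bigD1 i)//= -expr2 lerDl.
by apply: sumr_ge0 => j _; rewrite -expr2 sqr_ge0.
Qed.

Lemma enorm_le_sum x : enorm x <= \sum_i `|x ord0 i|.
Proof.
have S0 : 0 <= \sum_i `|x ord0 i| by apply: sumr_ge0.
rewrite -(ler_pXn2r (isT : (0 < 2)%N)) ?nnegrE ?enorm_ge0//.
rewrite enorm_sq expr2 mulr_suml; apply: ler_sum => i _.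
rewrite -expr2 -real_normK ?num_real// expr2 ler_wpM2l//.
by rewrite (bigD1 i)//= lerDl sumr_ge0.
Qed.

Lemma enorm_eq0 x : enorm x = 0 -> x = 0.
Proof.
move=> x0; apply/rowP => i; rewrite mxE; apply/eqP.
by rewrite -normr_le0 -x0 coord_le_enorm.
Qed.

(** Cauchy-Schwarz against a unit vector: expand the nonnegative square of [x - dotv x w *: w]. *)
Lemma dotv_le_enorm x w : enorm w = 1 -> dotv x w <= enorm x.
Proof.
move=> w1; have [|x_ge0] := leP (dotv x w) 0.
  by move=> /le_trans; apply; exact: enorm_ge0.
rewrite -(ler_pXn2r (isT : (0 < 2)%N)) ?nnegrE ?enorm_ge0 ?(ltW x_ge0)//.
have w2 : dotv w w = 1 by rewrite -enorm_sq w1 expr1n.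
have := dotvv_ge0 (x - dotv x w *: w).
rewrite !dotvE w2 enorm_sq (dotvC w x); lra.
Qed.

(** Balls of the ambient topology are coordinatewise, and coordinates are bounded by [enorm], so
    each contains a Euclidean ball; halving the radius makes it closed. *)
Lemma interior_enorm (A : set V) x : interior A x ->
  exists2 r, 0 < r & forall v, enorm v <= r -> A (x + v).
Proof.
move=> /nbhs_ballP[e /= e0 eA]; exists (e / 2); first by lra.
move=> v ve; apply: eA; split=> // i j; rewrite ord1 /ball/= !mxE.
by rewrite opprD addrA subrr sub0r normrN (le_lt_trans (coord_le_enorm _ _))//; lra.
Qed.

Lemma closed_enorm (A : set V) x : closed A -> ~ A x ->
  exists2 r, 0 < r & forall v, enorm v <= r -> ~ A (x + v).
Proof.
move=> cA nAx; have : interior (~` A) x.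
  by apply: open_nbhs_nbhs; split => //; exact: closed_openC.
exact: interior_enorm.
Qed.

Lemma dotv_continuous u : continuous (fun x => dotv x u).
Proof.
move=> x; rewrite /dotv; apply: cvg_big => [||i _]; [exact: add_continuous|exact: nbhs_filter|].
apply: cvgM; [exact: nbhs_filter|exact: coord_continuous|].
by apply: cvg_cst; exact: nbhs_filter.
Qed.

End Euclid.

(** * Hausdorff measure *)

Section Hausdorff.
Variables (R : realType) (n : nat).
Local Notation V := 'rV[R]_n.
Implicit Types (A B U : set V) (s k : nat) (c d delta : R) (f : V -> V).

Lemma unit_ball_vol_ge0 k : 0 <= unit_ball_vol R k.
Proof.
(* The recursion goes down by two, so the induction carries two consecutive values. *)
suff: 0 <= unit_ball_vol R k /\ 0 <= unit_ball_vol R k.+1 by case.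
elim: k => [|k [IH1 IH2]]; split=> //=.
by apply: mulr_ge0 => //; rewrite divr_ge0// mulr_ge0// pi_ge0.
Qed.

Lemma diam_ge0 U : 0 <= diam U.
Proof.
rewrite /diam; set S := [set _ | _ in _ & _ in _].
have [hS|/sup_out->//] := pselect (has_sup S).
have [[_ [x Ux [y Uy _]]] ubS] := hS.
apply: (@le_trans _ _ (enorm (x - x))); first exact: enorm_ge0.
by apply: ub_le_sup => //; exists x => //; exists x.
Qed.

Lemma diam_le U d : U !=set0 ->
  (forall x y, U x -> U y -> enorm (x - y) <= d) -> diam U <= d.
Proof.
move=> [x Ux] Ud; apply: ge_sup; last by move=> _ [y Uy [z Uz <-]]; exact: Ud.
by exists (enorm (x - x)), x => //; exists x.
Qed.

(** The bound [d] makes the supremum genuine: on an unbounded set [diam] takes the default value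
    0. *)
Lemma enorm_le_diam U d x y :
  (forall x y, U x -> U y -> enorm (x - y) <= d) -> U x -> U y ->
  enorm (x - y) <= diam U.
Proof.
move=> Ud Ux Uy; apply: ub_le_sup; last by exists x => //; exists y.
by exists d => _ [z Uz [w Uw <-]]; exact: Ud.
Qed.

Lemma haus_term_set0 s : haus_term s (set0 : set V) = 0.
Proof. by rewrite /haus_term asboolT. Qed.

Lemma haus_termE s U : U !=set0 ->
  haus_term s U = unit_ball_vol R s * (diam U / 2) ^+ s.
Proof. by move=> /set0P/eqP U0; rewrite /haus_term asboolF. Qed.

Lemma haus_term_ge0 s U : 0 <= haus_term s U.
Proof.
have [->|/set0P U0] := eqVneq U set0; first by rewrite haus_term_set0.
by rewrite haus_termE// mulr_ge0 ?unit_ball_vol_ge0// exprn_ge0// divr_ge0 ?diam_ge0.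
Qed.

Lemma haus_term_le s U d : 0 <= d ->
  (forall x y, U x -> U y -> enorm (x - y) <= d) ->
  haus_term s U <= unit_ball_vol R s * (d / 2) ^+ s.
Proof.
move=> d0 Ud; have [->|/set0P U0] := eqVneq U set0.
  by rewrite haus_term_set0 mulr_ge0 ?unit_ball_vol_ge0// exprn_ge0// divr_ge0.
rewrite haus_termE// ler_wpM2l ?unit_ball_vol_ge0// lerXn2r ?nnegrE ?divr_ge0 ?diam_ge0//.
by rewrite ler_wpM2r ?diam_le.
Qed.

Definition lipschitz_enorm c f := forall x y, enorm (f x - f y) <= c * enorm (x - y).

Lemma haus_term_lip s f c d U : 0 <= c -> lipschitz_enorm c f ->
  (forall x y, U x -> U y -> enorm (x - y) <= d) ->
  haus_term s (f @` U) <= c ^+ s * haus_term s U.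
Proof.
move=> c0 fc Ud; have [->|/set0P U0] := eqVneq U set0.
  by rewrite image_set0 haus_term_set0 mulr0.
rewrite (haus_termE _ _ U0) mulrCA -exprMn mulrA.
apply: haus_term_le; first by rewrite mulr_ge0 ?diam_ge0.
move=> _ _ [x Ux <-] [y Uy <-]; rewrite (le_trans (fc _ _))// ler_wpM2l//.
exact: enorm_le_diam Ud _ _.
Qed.

Lemma haus_sum_ge0 s (U : nat -> set V) :
  (0 <= \sum_(i <oo) (haus_term s (U i))%:E)%E.
Proof. by apply: nneseries_ge0 => i _ _; rewrite lee_fin haus_term_ge0. Qed.

Lemma hausdorff_delta_ge0 s delta A : (0 <= hausdorff_delta s delta A)%E.
Proof. by apply: le_ereal_inf_tmp => _ [U _ <-]; exact: haus_sum_ge0. Qed.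

Lemma hausdorff_delta_le s delta A : 0 < delta ->
  (hausdorff_delta s delta A <= hausdorff s A)%E.
Proof. by move=> d0; apply: ereal_sup_ubound; exists delta. Qed.

Lemma hausdorff_ge0 s A : (0 <= hausdorff s A)%E.
Proof.
exact: le_trans (hausdorff_delta_ge0 s 1 A) (hausdorff_delta_le _ _ _ ltr01).
Qed.

Lemma hausdorff_le s A (M : \bar R) :
  (forall delta, 0 < delta -> (hausdorff_delta s delta A <= M)%E) ->
  (hausdorff s A <= M)%E.
Proof. by move=> AM; apply: ge_ereal_sup => _ [d d0 <-]; exact: AM. Qed.

Lemma hausdorff_delta_anti s d1 d2 A : d1 <= d2 ->
  (hausdorff_delta s d2 A <= hausdorff_delta s d1 A)%E.
Proof.
move=> d12; apply: le_ereal_inf_tmp => _ [U [AU Ud] <-].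
apply: ereal_inf_lbound; exists U => //; split=> // i x y Ux Uy.
exact: le_trans (Ud i _ _ Ux Uy) d12.
Qed.

Lemma le_hausdorff s A B : A `<=` B -> (hausdorff s A <= hausdorff s B)%E.
Proof.
move=> AB; apply: hausdorff_le => d d0.
apply: le_trans (hausdorff_delta_le s d B d0).
apply: le_ereal_inf_tmp => _ [U [BU Ud] <-].
by apply: ereal_inf_lbound; exists U => //; split=> // x /AB /BU.
Qed.

Lemma hausdorff_delta_lip s f c delta A : 0 < c -> lipschitz_enorm c f ->
  (hausdorff_delta s (c * delta) (f @` A) <= (c ^+ s)%:E * hausdorff_delta s delta A)%E.
Proof.
move=> c0 fc; rewrite -lee_pdivrMl ?exprn_gt0//.
apply: le_ereal_inf_tmp => _ [U [AU Ud] <-]; rewrite lee_pdivrMl ?exprn_gt0//.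
apply: (@le_trans _ _ (\sum_(i <oo) (haus_term s (f @` U i))%:E)%E).
  apply: ereal_inf_lbound; exists (fun i => f @` U i) => //; split.
    by move=> _ [x /AU[i _ Ux] <-]; exists i => //; exists x.
  move=> i _ _ [x Ux <-] [y Uy <-]; rewrite (le_trans (fc _ _))//.
  by rewrite ler_wpM2l ?(ltW c0)//; exact: Ud Ux Uy.
rewrite -nneseriesZl; last by move=> i _; rewrite lee_fin haus_term_ge0.
apply: lee_nneseries => [i _ _|i _]; first by rewrite lee_fin haus_term_ge0.
by rewrite -EFinM lee_fin; apply: haus_term_lip fc (Ud i); exact: ltW.
Qed.

Lemma hausdorff_lip s f c A : 0 < c -> lipschitz_enorm c f ->
  (hausdorff s (f @` A) <= (c ^+ s)%:E * hausdorff s A)%E.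
Proof.
move=> c0 fc; apply: hausdorff_le => d d0.
have -> : d = c * (d / c) by rewrite mulrCA divff ?mulr1// gt_eqF.
apply: le_trans (hausdorff_delta_lip _ _ _ _ _ c0 fc) _.
apply: lee_wpmul2l; first by rewrite lee_fin exprn_ge0// ltW.
by apply: hausdorff_delta_le; rewrite divr_gt0.
Qed.

(** * Additivity over separated sets *)

Lemma hausdorff_delta_setU s d delta A B : delta < d ->
  (forall x y, A x -> B y -> d <= enorm (x - y)) ->
  (hausdorff_delta s delta A + hausdorff_delta s delta B <=
   hausdorff_delta s delta (A `|` B))%E.
Proof.
move=> dd AB; apply: le_ereal_inf_tmp => _ [U [ABU Ud] <-].
(* A cover member has diameter at most [delta < d], so it cannot meet both [A] and [B]. Keeping the
   members that meet [D] splits the cover; the discarded ones become empty and cost 0, even for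
   [s = 0]. *)
pose W (D : set V) i := if asbool (U i `&` D !=set0) then U i else set0.
have cW (D : set V) : D `<=` A `|` B -> delta_cover delta D (W D).
  move=> DAB; split.
    move=> x Dx; have [i _ Ux] := ABU _ (DAB _ Dx); exists i => //.
    by rewrite /W asboolT//; exists x.
  by move=> i x y; rewrite /W; case: asboolP => // _; exact: Ud.
have h (D : set V) : D `<=` A `|` B ->
    (hausdorff_delta s delta D <= \sum_(i <oo) (haus_term s (W D i))%:E)%E.
  by move=> DAB; apply: ereal_inf_lbound; exists (W D) => //; exact: cW.
apply: le_trans (leeD (h A _) (h B _)) _; [by left|by right|].
rewrite -nneseriesD; [|by move=> i _ _; rewrite lee_fin haus_term_ge0..].
apply: lee_nneseries => [i _ _|i _].
  by rewrite adde_ge0// lee_fin haus_term_ge0.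
rewrite -EFinD lee_fin /W.
case: asboolP => [[x [Ux Ax]]|_]; case: asboolP => [[y [Uy By]]|_];
  rewrite ?haus_term_set0 ?addr0 ?add0r ?haus_term_ge0//.
have := le_lt_trans (le_trans (AB _ _ Ax By) (Ud i _ _ Ux Uy)) dd.
by rewrite ltxx.
Qed.

Lemma hausdorff_setU s d A B : 0 < d ->
  (forall x y, A x -> B y -> d <= enorm (x - y)) ->
  (hausdorff s A + hausdorff s B <= hausdorff s (A `|` B))%E.
Proof.
move=> d0 AB; have [->|ABoo] := eqVneq (hausdorff s (A `|` B)) +oo%E.
  exact: leey.
have fin (X : \bar R) : (0 <= X <= hausdorff s (A `|` B))%E -> X \is a fin_num.
  move=> /andP[X0 XAB]; rewrite ge0_fin_numE// (le_lt_trans XAB)//.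
  by rewrite ltey.
have fd D e : D `<=` A `|` B -> 0 < e -> hausdorff_delta s e D \is a fin_num.
  move=> DAB e0; apply: fin; rewrite hausdorff_delta_ge0/=.
  exact: le_trans (hausdorff_delta_le _ _ _ e0) (le_hausdorff _ _ _ DAB).
(* Independent scales for [A] and [B] allow the two suprema to be taken one after the other; a
   common smaller scale below [d] reduces to the previous lemma. *)
have key e1 e2 : 0 < e1 -> 0 < e2 ->
    (hausdorff_delta s e1 A + hausdorff_delta s e2 B <= hausdorff s (A `|` B))%E.
  move=> e10 e20; pose e := Num.min (d / 2) (Num.min e1 e2).
  have e0 : 0 < e by rewrite !lt_min e10 e20 divr_gt0.
  have ed : e < d by rewrite gt_min; apply/orP; left; lra.
  have e1e : e <= e1 by rewrite !ge_min lexx orbT.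
  have e2e : e <= e2 by rewrite !ge_min lexx !orbT.
  apply: le_trans (leeD (hausdorff_delta_anti s _ _ A e1e)
                        (hausdorff_delta_anti s _ _ B e2e)) _.
  exact: le_trans (hausdorff_delta_setU _ _ _ _ _ ed AB) (hausdorff_delta_le _ _ _ e0).
have fB : hausdorff s B \is a fin_num.
  by apply: fin; rewrite hausdorff_ge0 le_hausdorff//; right.
rewrite -leeBrDr//; apply: hausdorff_le => e1 e10.
rewrite leeBrDr// addeC -leeBrDr ?fd//.
apply: hausdorff_le => e2 e20; rewrite leeBrDr ?fd//.
by rewrite addeC key.
Qed.

Lemma hausdorff_bigcup s d (A : nat -> set V) N : 0 < d ->
  (forall i j x y, (i < j < N)%N -> A i x -> A j y -> d <= enorm (x - y)) ->
  (\sum_(i < N) hausdorff s (A i) <= hausdorff s (\bigcup_(i < N) A i))%E.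
Proof.
move=> d0; elim: N => [|N IH] Ad; first by rewrite big_ord0 hausdorff_ge0.
rewrite big_ord_recr/=; apply: le_trans (leeD2r _ (IH _)) _.
  by move=> i j x y /andP[ij jN]; apply: Ad; rewrite ij ltnW.
apply: le_trans (hausdorff_setU s d _ _ d0 _) (le_hausdorff _ _ _ _).
  by move=> x y [i /= iN Ax] Ay; apply: Ad Ax Ay; rewrite iN/=.
move=> x [[i /= iN Ax]|Ax]; last by exists N => /=.
by exists i => //=; exact: ltnW.
Qed.

Lemma hausdorff_le_finite_covers s A (M : R) :
  (forall delta, 0 < delta -> exists (T : finType) (U : T -> set V) (b : R),
    [/\ A `<=` \bigcup_t U t,
        (forall t x y, U t x -> U t y -> enorm (x - y) <= delta),
        (forall t, haus_term s (U t) <= b) & #|T|%:R * b <= M]) ->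
  (hausdorff s A <= M%:E)%E.
Proof.
move=> cov; apply: hausdorff_le => delta /cov[T [U [b [AU Ud Ub TbM]]]].
(* The finite cover is padded with empty sets, which cost nothing. *)
pose W i := nth set0 [seq U t | t <- enum T] i.
have W0 i : (#|T| <= i)%N -> W i = set0.
  by move=> Ti; rewrite /W nth_default// size_map -cardE.
have WP i : W i = set0 \/ exists t, W i = U t.
  have [/W0|iT] := leqP #|T| i; [by left|right].
  have /card_gt0P[t _] : (0 < #|T|)%N by exact: leq_ltn_trans iT.
  by exists (nth t (enum T) i); rewrite /W (nth_map t)// -cardE.
apply: (@le_trans _ _ (\sum_(i <oo) (haus_term s (W i))%:E)%E).
  apply: ereal_inf_lbound; exists W => //; split.
    move=> x /AU[t _ Ux]; exists (index t (enum T)) => //.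
    by rewrite /W (nth_map t) ?index_mem ?mem_enum// nth_index ?mem_enum.
  by move=> i x y; have [->//|[t ->]] := WP i; exact: Ud.
rewrite (nneseries_split 0%N #|T|); last by move=> i _; rewrite lee_fin haus_term_ge0.
rewrite add0n [X in (_ + X)%E]eseries0 ?adde0; last first.
  by move=> i iT _; rewrite W0// haus_term_set0.
rewrite sumEFin lee_fin; apply: le_trans TbM.
rewrite big_mkord mulr_natl -[X in _ *+ X](card_ord #|T|) -sumr_const; apply: ler_sum => i _.
have [Wi|[t ->]] := WP i; last exact: Ub.
have /card_gt0P[t _] : (0 < #|T|)%N by exact: leq_ltn_trans (ltn_ord i).
by rewrite Wi haus_term_set0 (le_trans (haus_term_ge0 s (U t))).
Qed.

End Hausdorff.

(** * Lower integrals and equal values *)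

Section Integral.
Variables (R : realType) (n : nat).
Local Notation V := 'rV[R]_n.
Implicit Types (A B E : set V) (f g : V -> R) (mu : set V -> \bar R).

Lemma Borel0 : Borel (set0 : set V).
Proof. by have [] := @smallest_sigma_algebra V setT [set U | open U]. Qed.

Lemma Borel_set1 (x : V) : Borel [set x].
Proof.
rewrite -(setCK [set x]) -setTD.
have [_ + _] := @smallest_sigma_algebra V setT [set U | open U]; apply.
apply: sub_sigma_algebra; apply: closed_openC.
apply: accessible_closed_set1; exact/hausdorff_accessible/norm_hausdorff.
Qed.

(** The sets with Borel preimage form a sigma-algebra containing the open sets. *)
Lemma Borel_preimage_scale (a : R) A : Borel A -> Borel [set x | A (a *: x)].
Proof.
have [B0 BD BU] := @smallest_sigma_algebra V setT [set U | open U].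
apply: (@smallest_sub _ (sigma_algebra setT) _ [set A | Borel [set x | A (a *: x)]]).
  by split => [|D BorD|F BorF]; [exact: B0|exact: BD BorD|exact: BU BorF].
move=> U oU; apply: sub_sigma_algebra => /=.
by apply: (@open_comp _ _ (fun x : V => a *: x)) => // x _; exact: scaler_continuous.
Qed.

Lemma inf_image_ge0 E f : (forall x, E x -> 0 <= f x) -> 0 <= inf [set f x | x in E].
Proof.
move=> f0; have [->|/set0P[x Ex]] := eqVneq E set0.
  by rewrite image_set0 inf0.
apply: lb_le_inf; first by exists (f x), x.
by move=> _ [y Ey <-]; exact: f0.
Qed.

Lemma inf_image_le E f x : (forall x, E x -> 0 <= f x) -> E x ->
  inf [set f x | x in E] <= f x.
Proof.
by move=> f0 Ex; apply: ge_inf; [exists 0 => _ [y /f0 fy <-]|exists x].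
Qed.

Lemma nonneg_integral_ge0 mu A f : (0 <= nonneg_integral mu A f)%E.
Proof.
apply: ereal_sup_ubound; exists 0%N, (fun=> set0); split.
- by move=> _; exact: Borel0.
- by move=> _ x.
- by [].
- by rewrite big_ord0.
Qed.

Lemma nonneg_integral_null mu A f : (forall E, E `<=` A -> mu E = 0%E) ->
  nonneg_integral mu A f = 0%E.
Proof.
move=> mu0; apply/eqP; rewrite eq_le nonneg_integral_ge0 andbT.
apply: ge_ereal_sup => _ [k [E [_ EA _ ->]]].
by rewrite big1// => i _; rewrite mu0 ?mule0.
Qed.

Lemma le_nonneg_integral mu A f g (c : R) : (forall E, (0 <= mu E)%E) -> 0 < c ->
  (forall x, A x -> 0 <= f x) -> (forall x, A x -> f x <= c * g x) ->
  (nonneg_integral mu A f <= c%:E * nonneg_integral mu A g)%E.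
Proof.
move=> mu0 c0 f0 fg; apply: ge_ereal_sup => _ [k [E [bE EA dE ->]]].
apply: (@le_trans _ _ (c%:E * \sum_(i < k) (inf [set g x | x in E i])%:E * mu (E i))%E).
  have g0 x : A x -> 0 <= g x.
    by move=> Ax; rewrite -(pmulr_rge0 _ c0) (le_trans (f0 _ Ax))// fg.
  rewrite ge0_sume_distrr; last first.
    by move=> i _; rewrite mule_ge0// lee_fin inf_image_ge0// => x /EA/g0.
  apply: lee_sum => i _; rewrite muleA -EFinM lee_wpmul2r// lee_fin.
  (* On an empty piece both infima take the default value 0. *)
  have [->|/set0P[x Ex]] := eqVneq (E i) set0; first by rewrite !image_set0 inf0 mulr0.
  rewrite -ler_pdivrMl//; apply: lb_le_inf; first by exists (g x), x.
  move=> _ [y Ey <-]; rewrite ler_pdivrMl// (le_trans _ (fg _ (EA _ _ Ey)))//.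
  by apply: inf_image_le => // z /EA /f0.
rewrite lee_pmul2l ?lte_fin//; apply: ereal_sup_ubound; exists k, E; split=> //.
Qed.

(** Pieces of [B] are pulled back to [A] by [x |-> a *: x]: the infima are unchanged and the
    Hausdorff measure grows by at most [a ^+ s]. Equality follows below by also using the factor
    [a^-1]. *)
Lemma le_nonneg_integral_hausdorff_scale s (a : R) A B f : 0 < a ->
  (forall x, B x -> A (a^-1 *: x)) -> (forall x, B x -> 0 <= f x) ->
  (nonneg_integral (hausdorff s) B f <=
   (a ^+ s)%:E * nonneg_integral (hausdorff s) A (fun x => f (a *: x)%R))%E.
Proof.
move=> a0 BA f0; apply: ge_ereal_sup => _ [k [E [bE EB dE ->]]].
have aN0 : a != 0 by rewrite gt_eqF.
pose F i := [set x | E i (a *: x)].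
have FE i : [set a *: x | x in F i] = E i.
  apply/seteqP; split=> [_ [x Fx <-]//|x Ex]; exists (a^-1 *: x).
    by rewrite /F/= scalerA divff// scale1r.
  by rewrite scalerA divff// scale1r.
have infE i : inf [set f (a *: x) | x in F i] = inf [set f x | x in E i].
  by rewrite -(FE i) -image_comp.
apply: (@le_trans _ _ ((a ^+ s)%:E *
    \sum_(i < k) (inf [set f (a *: x)%R | x in F i])%:E * hausdorff s (F i))%E).
  have infge0 i : (0 <= (inf [set f x | x in E i])%:E)%E.
    by rewrite lee_fin inf_image_ge0// => x /EB/f0.
  rewrite ge0_sume_distrr; last first.
    by move=> i _; rewrite mule_ge0 ?hausdorff_ge0// infE.
  apply: lee_sum => i _; rewrite muleCA infE lee_wpmul2l//.
  rewrite -{1}FE; apply: hausdorff_lip => // x y.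
  by rewrite -scalerBr enormZ gtr0_norm.
rewrite lee_pmul2l ?lte_fin ?exprn_gt0//; apply: ereal_sup_ubound.
exists k, F; split=> //.
- by move=> i; exact: Borel_preimage_scale.
- by move=> i x /EB /BA; rewrite scalerA mulVf// scale1r.
- move=> i j ik jk ij; have := dE i j ik jk ij; rewrite -!subset0 => Eij x [].
  by rewrite /F/= => Ei Ej; exact: (Eij (a *: x)).
Qed.

Lemma nonneg_integral_hausdorff_scale s (a : R) A B f : 0 < a ->
  (forall x, B x -> A (a^-1 *: x)) -> (forall x, A x -> B (a *: x)) ->
  (forall x, 0 <= f x) ->
  nonneg_integral (hausdorff s) B f =
   ((a ^+ s)%:E * nonneg_integral (hausdorff s) A (fun x => f (a *: x)%R))%E.
Proof.
move=> a0 BA AB f0; apply/eqP; rewrite eq_le le_nonneg_integral_hausdorff_scale//=.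
have aV0 : 0 < a^-1 by rewrite invr_gt0.
have aN0 : a != 0 by rewrite gt_eqF.
rewrite -lee_pdivlMl ?exprn_gt0// -exprVn.
apply: le_trans (le_nonneg_integral_hausdorff_scale s a^-1 B A _ aV0 _ _) _ => //.
  by move=> x /AB; rewrite invrK.
under [in leLHS]eq_fun do rewrite scalerA divff// scale1r.
by [].
Qed.

End Integral.

(** * Two equal values by the intermediate value theorem *)

Section EqualValues.
Variables (R : realType) (J : R -> R) (n : nat) (M : R).

(** The function [g t = t ^+ n * J t] is continuous and is larger at 1 than at some [a < 1] and some
    [b > 1], so a value between is taken on both sides of 1. *)
Lemma exists_equal_values : (0 < n)%N -> 0 <= M -> 0 < J 1 ->
  (forall t s, 0 < t -> t <= s -> J s <= expR (- ((s ^+ 2 - t ^+ 2) / 2)) * J t) ->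
  (forall t s, 0 < t -> t <= s -> expR (- ((s ^+ 2 - t ^+ 2) * M)) * J t <= J s) ->
  exists t s, [/\ 0 < t, t < s & t ^+ n * J t = s ^+ n * J s].
Proof.
move=> n0 M0 J1 Jup Jlo; pose g t := t ^+ n * J t.
have Jge0 t : 0 < t -> 0 <= J t.
  move=> t0; have [t1|/ltW t1] := leP t 1.
    rewrite -(pmulr_rge0 _ (expR_gt0 (- ((1 ^+ 2 - t ^+ 2) / 2)))).
    exact: le_trans (ltW J1) (Jup _ _ t0 t1).
  apply: le_trans (Jlo _ _ ltr01 t1).
  by rewrite mulr_ge0 ?expR_ge0 ?ltW.
have Jdec t s : 0 < t -> t <= s -> J s <= J t.
  move=> t0 ts; apply: le_trans (Jup _ _ t0 ts) _.
  by rewrite -[leRHS]mul1r ler_wpM2r ?Jge0// -[leRHS]expR0 ler_expR; nra.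
have Jinc t s : 0 < t -> t <= s -> J t - J s <= (s ^+ 2 - t ^+ 2) * M * J t.
  move=> t0 ts; have := Jlo _ _ t0 ts.
  have := expR_ge1Dx (- ((s ^+ 2 - t ^+ 2) * M)); have := Jge0 _ t0; nra.
have Jcont t : 0 < t -> {for t, continuous J}.
  (* [L] is a Lipschitz constant of [J] on [[t / 2, 2 * t]]: there [x + y <= 4 * t] and
     [J x <= J (t / 2)]. *)
  move=> t0; pose L := 4 * t * M * J (t / 2).
  have t20 : 0 < t / 2 by lra.
  have L0 : 0 <= L by rewrite !mulr_ge0 ?Jge0// ltW.
  have JL x y : t / 2 <= x -> x <= y -> y <= 2 * t -> J x - J y <= L * (y - x).
    move=> tx xy yt; have x0 : 0 < x := lt_le_trans t20 tx.
    apply: le_trans (Jinc _ _ x0 xy) _.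
    have Jx := Jdec _ _ t20 tx.
    have -> : L * (y - x) = ((y - x) * (4 * t) * M) * J (t / 2) by rewrite /L; ring.
    apply: ler_pM => //; [|exact: Jge0|].
      by rewrite mulr_ge0//; nra.
    by rewrite ler_wpM2r//; nra.
  apply/cvgrPdist_le => e e0; apply/nbhs_ballP.
  exists (Num.min (t / 2) (e / (L + 1))).
    by rewrite /= lt_min t20 divr_gt0//; lra.
  move=> s; rewrite /ball/= lt_min => /andP[ts se].
  have {}se : L * `|t - s| <= e.
    rewrite ltr_pdivlMr in se; last by lra.
    by have := normr_ge0 (t - s); nra.
  move: ts; rewrite ltr_norml => /andP[ts1 ts2].
  have [st|/ltW st] := leP s t.
    rewrite distrC ger0_norm ?subr_ge0 ?Jdec//; last by lra.
    by move: se; rewrite ger0_norm ?subr_ge0//; apply: le_trans; apply: JL => //; lra.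
  rewrite ger0_norm ?subr_ge0 ?Jdec//.
  by move: se; rewrite distrC ger0_norm ?subr_ge0//; apply: le_trans; apply: JL => //; lra.
have gcont a b : 0 < a -> {within `[a, b], continuous g}.
  move=> a0; apply: continuous_in_subspaceT => x; rewrite inE/= in_itv/= => /andP[ax _].
  apply: cvgM; first exact: exprn_continuous.
  by apply: Jcont; exact: lt_le_trans ax.
(* Since [J a <= expR M * J 1], this choice gives [g a <= a * J a <= J 1 / 2]. *)
pose a : R := expR (- M) / 2.
have a0 : 0 < a by rewrite divr_gt0 ?expR_gt0.
have a1 : a < 1.
  have : expR (- M) <= 1 by rewrite -expR0 ler_expR oppr_le0.
  by rewrite /a; lra.
have ga : g a < g 1.
  rewrite /g expr1n mul1r; apply: (@le_lt_trans _ _ (a * J a)).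
    rewrite ler_wpM2r ?Jge0//; case: n n0 => // m _.
    by rewrite exprS ger_pMr// exprn_ile1// ltW.
  have aM : expR (- M) * J a <= J 1.
    apply: le_trans (Jlo _ _ a0 (ltW a1)).
    rewrite ler_wpM2r ?Jge0// ler_expR lerN2 expr1n; have := sqr_ge0 a; nra.
  by rewrite /a mulrAC; lra.
(* Here [(b ^+ 2 - 1) / 2 = n * (2 * n + 2)], and [expR (2 * n + 2) >= 2 * n + 3 > b], so the
   exponential decay beats [b ^+ n]. *)
pose b : R := (n.*2.+1)%:R.
have b1 : 1 < b by rewrite ltr1n ltnS double_gt0.
have gb : g b < g 1.
  rewrite /g expr1n mul1r; have b0 : 0 < b by lra.
  have nR : 0 < n%:R :> R by rewrite ltr0n.
  have bE : b = 2 * n%:R + 1 by rewrite /b -addn1 natrD -mul2n natrM.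
  apply: (@le_lt_trans _ _ (b ^+ n * (expR (- ((b ^+ 2 - 1 ^+ 2) / 2)) * J 1))).
    by rewrite ler_wpM2l ?exprn_ge0 ?(ltW b0)// Jup// ltW.
  rewrite mulrA gtr_pMl// expRN ltr_pdivrMr ?expR_gt0// mul1r.
  have -> : (b ^+ 2 - 1 ^+ 2) / 2 = n%:R * (2 * n%:R + 2) by rewrite bE; field.
  rewrite expRM_natl; apply: (@lt_le_trans _ _ ((1 + (2 * n%:R + 2)) ^+ n)).
    by rewrite ltrXn2r ?nnegrE -?lt0n//; lra.
  by rewrite lerXn2r ?nnegrE ?expR_ge0 ?expR_ge1Dx//; lra.
pose v := Num.max (g a) (g b).
have v1 : v < g 1 by rewrite gt_max ga gb.
have [t] : exists2 t, t \in `[a, 1] & g t = v.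
  apply: IVT; [exact: ltW|exact: gcont|].
  by rewrite ge_min le_max !le_max lexx (ltW v1) !orbT.
have [s] : exists2 s, s \in `[1, b] & g s = v.
  apply: IVT; [exact: ltW|exact: gcont|].
  by rewrite ge_min le_max !le_max lexx (ltW v1) !orbT.
rewrite !in_itv/= => /andP[s1 _] gs /andP[ta t1] gt.
exists t, s; split; [exact: lt_le_trans ta| |by rewrite -/(g t) -/(g s) gs].
rewrite (le_lt_trans t1)// lt_neqAle s1 andbT; apply: contraTneq v1 => ->.
by rewrite gs ltxx.
Qed.
End EqualValues.

(** The two comparisons make [I] infinite at 2 if it is infinite at 1, and likewise for 0; then 1
    and 2 serve as parameters. Otherwise [I] is finite at all positive arguments and the real case
    applies. *)
Lemma exists_equal_values_ereal (R : realType) (I : R -> \bar R) (n : nat) (M : R) :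
  (0 < n)%N -> 0 <= M -> (forall t, (0 <= I t)%E) ->
  (forall t s, 0 < t -> t <= s ->
    (I s <= (expR (- ((s ^+ 2 - t ^+ 2) / 2)))%:E * I t)%E) ->
  (forall t s, 0 < t -> t <= s -> (I t <= (expR ((s ^+ 2 - t ^+ 2) * M))%:E * I s)%E) ->
  exists t s, [/\ 0 < t, t < s & ((t ^+ n)%:E * I t = (s ^+ n)%:E * I s)%E].
Proof.
move=> n0 M0 I0 Ile Ige; have lt12 : (1 : R) < 2 by rewrite ltr1n.
have I12 := Ige _ _ ltr01 (ltW lt12); have I21 := Ile _ _ ltr01 (ltW lt12).
have [Ioo|Ifin] := eqVneq (I 1) +oo%E.
  exists 1, 2; split; [exact: ltr01|exact: lt12|]; have : I 2 = +oo%E.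
    apply/eqP; rewrite -leye_eq leNgt; apply/negP => I2.
    by move: I12; rewrite Ioo leNgt lte_mul_pinfty// lee_fin expR_ge0.
  by move=> ->; rewrite Ioo !gt0_muley// lte_fin exprn_gt0.
have [I1|I1] := eqVneq (I 1) 0%E.
  exists 1, 2; split; [exact: ltr01|exact: lt12|]; rewrite I1 mule0.
  suff -> : I 2 = 0%E by rewrite mule0.
  by apply/eqP; rewrite eq_le I0 andbT (le_trans I21)// I1 mule0.
have I1oo : (I 1%R < +oo)%E by rewrite ltey.
have fin t : 0 < t -> I t \is a fin_num.
  move=> t0; rewrite ge0_fin_numE//.
  have [t1|/ltW t1] := leP t 1.
    by rewrite (le_lt_trans (Ige _ _ t0 t1))// lte_mul_pinfty// lee_fin expR_ge0.
  by rewrite (le_lt_trans (Ile _ _ ltr01 t1))// lte_mul_pinfty// lee_fin expR_ge0.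
have J1 : 0 < fine (I 1) by rewrite fine_gt0// I1oo lt_neqAle eq_sym I1 I0.
have Jle t s : 0 < t -> t <= s ->
    fine (I s) <= expR (- ((s ^+ 2 - t ^+ 2) / 2)) * fine (I t).
  move=> t0 ts; have s0 : 0 < s by exact: lt_le_trans ts.
  by rewrite -lee_fin EFinM !fineK ?fin//; exact: Ile.
have Jge t s : 0 < t -> t <= s ->
    expR (- ((s ^+ 2 - t ^+ 2) * M)) * fine (I t) <= fine (I s).
  move=> t0 ts; have s0 : 0 < s by exact: lt_le_trans ts.
  by rewrite expRN ler_pdivrMl ?expR_gt0// -lee_fin EFinM !fineK ?fin//; exact: Ige.
have [t [s [t0 ts E]]] :=
  exists_equal_values R (fun t => fine (I t)) n M n0 M0 J1 Jle Jge.
have s0 : 0 < s by exact: lt_trans ts.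
exists t, s; split; [exact: t0|exact: ts|].
by rewrite -(fineK (fin _ t0)) -(fineK (fin _ s0)) -!EFinM E.
Qed.

(** * Null relative boundaries and bounded slices *)

Section HausdorffFace.
Variables (R : realType).

Lemma ereal_archi_eq0 (x y : \bar R) : (0 <= x)%E -> (y < +oo)%E ->
  (forall N, (0 < N)%N -> (N%:R%:E * x <= y)%E) -> x = 0%E.
Proof.
move=> x0 yoo xy; have x_fin : x \is a fin_num.
  by rewrite ge0_fin_numE// (le_lt_trans _ yoo)//; have := xy 1%N isT; rewrite mul1e.
have y_fin : y \is a fin_num.
  by rewrite ge0_fin_numE// (le_trans x0)//; have := xy 1%N isT; rewrite mul1e.
rewrite -(fineK x_fin) -(fineK y_fin) in xy x0 *.
set a := fine x in x0 xy *; set b := fine y in xy *.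
rewrite lee_fin in x0; congr EFin; apply/eqP; rewrite eq_le x0 andbT.
rewrite leNgt; apply/negP => a0.
have b0 : 0 <= b by have := xy 1%N isT; rewrite -EFinM lee_fin mul1r; apply: le_trans.
have := archi_boundP (divr_ge0 b0 (ltW a0)); rewrite ltr_pdivrMr//.
set N := Num.bound _ => bN.
have := xy N.+1 isT; rewrite -EFinM lee_fin -natr1 mulrDl mul1r => h.
by have := lt_le_trans bN (le_trans _ h); rewrite lerDl x0 ltxx => /(_ isT).
Qed.

Lemma homothety_lipschitz n (p : 'rV[R]_n) (c d : R) : 0 <= c -> c <= d ->
  lipschitz_enorm R n d (fun x => c *: x + (1 - c) *: p).
Proof.
move=> c0 cd x y; rewrite opprD addrACA subrr addr0 -scalerBr enormZ ger0_norm//.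
by rewrite ler_wpM2r ?enorm_ge0.
Qed.

(* The homothetic copies c E + (1 - c) p of E, for N values of c in [1/2, 1],
   are pairwise at positive distance because x in E is extremal in F in the
   direction w; they all lie in F and have measure at least 2^-s H^s(E). *)
Lemma hausdorff_rel_boundary_eq0 n s (F E : set 'rV[R]_n) (p : 'rV[R]_n) (r : R) :
  (forall x c, F x -> 0 <= c <= 1 -> F (c *: x + (1 - c) *: p)) ->
  (hausdorff s F < +oo)%E -> E `<=` F -> 0 < r ->
  (forall x, E x -> exists w, [/\ enorm w = 1,
     forall y, F y -> dotv (y - p) w <= dotv (x - p) w & r <= dotv (x - p) w]) ->
  hausdorff s E = 0%E.
Proof.
move=> Fp Foo EF r0 Ew.
apply: (@ereal_archi_eq0 _ ((2 ^+ s)%:E * hausdorff s F)); first exact: hausdorff_ge0.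
  by rewrite lte_mul_pinfty// lee_fin exprn_ge0.
move=> N N0; have NR : 0 < N%:R :> R by rewrite ltr0n.
(* The ratios lie in [[1/2, 1]] with gaps [1 / (2 * N)], which gives the separation [r / (2 * N)]
   below. *)
pose c (i : nat) : R := 1 - i%:R / (2 * N%:R).
have c_bnd i : (i < N)%N -> 2^-1 <= c i <= 1.
  move=> iN; have iNR : i%:R <= N%:R :> R by rewrite ler_nat ltnW.
  rewrite /c gerBl divr_ge0 ?mulr_ge0//; [|by rewrite ltW..].
  rewrite andbT lerBrDr -lerBrDl ler_pdivrMr; last by rewrite mulr_gt0.
  by rewrite mulrA; lra.
pose h i (x : 'rV[R]_n) := c i *: x + (1 - c i) *: p.
apply: (@le_trans _ _ ((2 ^+ s)%:E * \sum_(i < N) hausdorff s (h i @` E))%E).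
  rewrite ge0_sume_distrr; last by move=> i _; exact: hausdorff_ge0.
  have -> : (N%:R%:E * hausdorff s E = \sum_(i < N) hausdorff s E)%E.
    by rewrite mule_natl big_const_ord; elim: (N) => // m IHm; rewrite iterS -IHm; case: (m) => [|k]; rewrite ?mulr0n ?adde0 ?enatmulS.
  apply: lee_sum => i _; have /andP[ci1 ci2] := c_bnd _ (ltn_ord i).
  have ci0 : 0 < c i by lra.
  (* The inverse homothety has ratio at most 2, so it recovers [E] from its copy at the cost of a
     factor [2 ^+ s]. *)
  have {1}-> : E = (fun x => (c i)^-1 *: x + (1 - (c i)^-1) *: p) @` (h i @` E).
    have hK x : (c i)^-1 *: h i x + (1 - (c i)^-1) *: p = x.
      apply/rowP => k; rewrite /h !mxE; move: (c i) ci0 => a a0.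
      by field; rewrite gt_eqF.
    apply/seteqP; split=> [x Ex|_ [_ [x Ex <-] <-]]; last by rewrite hK.
    by exists (h i x); [exists x|rewrite hK].
  apply: hausdorff_lip => //; apply: homothety_lipschitz.
    by rewrite invr_ge0 ltW.
  by rewrite invf_ple ?posrE// ltr0n.
apply: lee_wpmul2l; first by rewrite lee_fin exprn_ge0.
apply: le_trans (hausdorff_bigcup _ _ s (r / (2 * N%:R)) (fun i => h i @` E) N _ _) _.
- by rewrite divr_gt0// mulr_gt0.
- move=> i j _ _ /andP[ij jN] [x Ex <-] [y Ey <-].
  have [w [w1 Fw rw]] := Ew _ Ex.
  apply: le_trans _ (dotv_le_enorm _ _ _ _ w1).
  have -> : h i x - h j y = c i *: (x - p) - c j *: (y - p).
    by apply/rowP => k; rewrite !mxE; ring.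
  have /andP[cj1 _] := c_bnd _ jN.
  rewrite dotvDl dotvNl !dotvZl.
  have Yle := Fw _ (EF _ Ey).
  have cji : r / (2 * N%:R) <= (c i - c j) * r.
    have -> : c i - c j = (j%:R - i%:R) / (2 * N%:R) by rewrite /c; field; rewrite gt_eqF.
    rewrite mulrAC ler_wpM2r ?invr_ge0 ?mulr_ge0//.
    by rewrite ler_peMl ?(ltW r0)// lerBrDr nat1r ler_nat.
  have cij : 0 <= c i - c j.
    by rewrite -(pmulr_lge0 _ r0) (le_trans _ cji)// divr_ge0 ?(ltW r0)// mulr_ge0.
  by nra.
- apply: le_hausdorff => _ [i /= iN [x Ex <-]]; apply: Fp; first exact: EF.
  by have /andP[ci1 ->] := c_bnd _ iN; rewrite andbT; lra.
Qed.

(** On the hyperplane one coordinate [i0] is an affine function of the others, so a grid in the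
    remaining [n - 1] coordinates covers [F] by cells of small diameter, with total cost independent
    of the mesh. *)
Lemma hausdorff_bounded_slice n (F : set 'rV[R]_n) (u : 'rV[R]_n) (b M : R) :
  u != 0 -> (forall x, F x -> dotv x u = b) -> (forall x, F x -> enorm x <= M) ->
  (hausdorff n.-1 F < +oo)%E.
Proof.
case: n F u => [|n] F u u0 Fb FM; first by case/eqP: u0; apply/rowP => -[].
have [i0 ui0] : exists i0, u ord0 i0 != 0.
  apply/existsP; apply: contraNT u0; rewrite negb_exists => /forallP h.
  by apply/eqP/rowP => i; rewrite mxE; apply/eqP; rewrite -[_ == _]negbK h.
pose L := `|M| + 1; have L0 : 0 < L by rewrite ltr_pwDr.
(* In a cell of side [h], the free coordinates of a difference contribute at most [n * h] to the
   norm; orthogonality to [u] bounds coordinate [i0] by the second summand times [h]. *)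
pose D := n%:R + (\sum_(k < n) `|u ord0 (lift i0 k)|) / `|u ord0 i0|.
have D0 : 0 <= D by rewrite addr_ge0// divr_ge0// sumr_ge0.
pose a : R := unit_ball_vol R n * (D * L) ^+ n.
apply: (@le_lt_trans _ _ a%:E); last by rewrite ltey.
apply: hausdorff_le_finite_covers => delta delta0.
(* Chosen so that [[-L, L]] cut into [N.+1] intervals has mesh [h] with [D * h <= delta]. *)
pose N := Num.trunc (2 * D * L / delta).
have NN0 : 0 < N.+1%:R :> R by rewrite ltr0n.
pose h := 2 * L / N.+1%:R; have h0 : 0 < h by rewrite divr_gt0// mulr_gt0.
have hN : N.+1%:R * h = 2 * L by rewrite /h mulrC divfK// gt_eqF.
have hdelta : D * h <= delta.
  have /andP[_] := truncn_itv (divr_ge0 (mulr_ge0 (mulr_ge0 (ler0n _ 2) D0) (ltW L0)) (ltW delta0)).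
  by rewrite -/N ltr_pdivrMr// => /ltW; rewrite /h mulrA ler_pdivrMr// mulrCA mulrA (mulrC delta).
pose U (f : {ffun 'I_n -> 'I_N.+1}) : set 'rV[R]_n.+1 := [set x | F x /\
  forall k, - L + (f k)%:R * h <= x ord0 (lift i0 k) <= - L + (f k).+1%:R * h].
have Ud f x y : U f x -> U f y -> enorm (x - y) <= D * h.
  move=> [Fx Ux] [Fy Uy]; pose z := x - y.
  have zk k : `|z ord0 (lift i0 k)| <= h.
    have := Ux k; have := Uy k; rewrite /z !mxE -natr1 mulrDl mul1r ler_norml.
    by move=> /andP[? ?] /andP[? ?]; apply/andP; split; lra.
  have zu : dotv z u = 0 by rewrite dotvDl dotvNl !Fb// subrr.
  have zi0 : `|z ord0 i0| <= (\sum_(k < n) `|u ord0 (lift i0 k)|) / `|u ord0 i0| * h.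
    rewrite mulrAC ler_pdivlMr ?normr_gt0// -normrM.
    move: zu; rewrite /dotv (bigD1_ord i0)//= => /eqP; rewrite addr_eq0 => /eqP ->.
    rewrite normrN (le_trans (ler_norm_sum _ _ _))// mulr_suml.
    by apply: ler_sum => k _; rewrite normrM mulrC ler_wpM2l.
  rewrite (le_trans (enorm_le_sum _ _ _))// (bigD1_ord i0)//= /D mulrDl addrC.
  apply: lerD => //; rewrite mulr_natl -[X in _ *+ X](card_ord n) -sumr_const.
  by apply: ler_sum => k _; exact: zk.
exists {ffun 'I_n -> 'I_N.+1}, U, (unit_ball_vol R n * (D * h / 2) ^+ n); split.
- move=> x Fx; pose q k := (x ord0 (lift i0 k) + L) / h.
  have xL k : `|x ord0 (lift i0 k)| < L.
    rewrite (le_lt_trans (coord_le_enorm _ _ _ _))// (le_lt_trans (FM _ Fx))//.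
    by rewrite /L (le_lt_trans (ler_norm M))// ltrDl.
  have q0 k : 0 <= q k.
    by have := xL k; rewrite ltr_norml => /andP[? _]; rewrite divr_ge0 ?(ltW h0)//; lra.
  have qN k : (Num.trunc (q k) < N.+1)%N.
    rewrite -(ltr_nat R); have /andP[tq _] := truncn_itv (q0 k).
    rewrite (le_lt_trans tq)// ltr_pdivrMr// hN.
    by have := xL k; rewrite ltr_norml => /andP[_ ?]; lra.
  exists [ffun k => Ordinal (qN k)] => //; split=> // k; rewrite ffunE/=.
  have /andP[q1 /ltW q2] := truncn_itv (q0 k).
  rewrite {2}/q ler_pdivlMr// in q1; rewrite {1}/q ler_pdivrMr// in q2.
  by apply/andP; split; lra.
- by move=> f x y Ux Uy; exact: le_trans (Ud f x y Ux Uy) hdelta.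
- move=> f; apply: haus_term_le; last exact: Ud.
  by rewrite mulr_ge0// ltW.
- rewrite card_ffun !card_ord natrX mulrCA -exprMn /a ler_wpM2l ?unit_ball_vol_ge0//.
  have -> : N.+1%:R * (D * h / 2) = D * L.
    have -> : N.+1%:R * (D * h / 2) = D * (N.+1%:R * h) / 2 by ring.
    by rewrite hN; field.
  by [].
Qed.

End HausdorffFace.

(** * Truncated cones *)

Section Cone.
Variables (R : realType) (n : nat) (C : set 'rV[R]_n).
Hypothesis coneC : closed_convex_cone C.
Local Notation V := 'rV[R]_n.
Implicit Types (u w x y p : V) (t r : R).

Lemma coneZ t x : 0 <= t -> C x -> C (t *: x).
Proof. by case: coneC => _ _ _ CZ t0 Cx; exact: CZ. Qed.

Lemma coneD x y : C x -> C y -> C (x + y).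
Proof.
move=> Cx Cy; case: coneC => _ _ Cconv _.
have -> : x + y = 2 *: ((1 - 2^-1) *: x + 2^-1 *: y).
  by apply/rowP => i; rewrite !mxE; field.
by apply: coneZ => //; apply: Cconv => //; rewrite invr_ge0 invf_le1//; lra.
Qed.

Lemma cone_sum (I : Type) (s : seq I) (f : I -> V) :
  (forall i, C (f i)) -> C (\sum_(i <- s) f i).
Proof.
move=> Cf; elim/big_ind: _ => //; last exact: coneD.
by case: coneC.
Qed.

(** The sum of a spanning family in [C] is interior: a small [v] has coefficients at least -1 in
    that family, so adding it leaves a nonnegative combination. *)
Lemma full_dim_interior_point : full_dim C ->
  exists p r, 0 < r /\ forall v, enorm v <= r -> C (p + v).
Proof.
move=> [s [sC sfull]]; pose X := in_tuple s.
have XC (i : 'I_(size s)) : C X`_i by apply: sC; exact: mem_nth.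
have coordX v : v = \sum_i coord X i v *: X`_i.
  by apply: coord_span; rewrite /X/= sfull memvf.
pose B := \sum_i \sum_(j < n) `|coord X i (delta_mx 0 j)|.
have B0 : 0 <= B by apply: sumr_ge0 => i _; exact: sumr_ge0.
have coordB v i : `|coord X i v| <= enorm v * B.
  rewrite {1}[v]row_sum_delta linear_sum.
  rewrite (le_trans (ler_norm_sum _ _ _))//.
  apply: (@le_trans _ _ (enorm v * \sum_(j < n) `|coord X i (delta_mx 0 j)|)).
    rewrite mulr_sumr; apply: ler_sum => j _; rewrite linearZ normrM.
    by rewrite ler_wpM2r// coord_le_enorm.
  rewrite ler_wpM2l ?enorm_ge0// /B [leRHS](bigD1 i)//= lerDl.
  by apply: sumr_ge0 => k _; exact: sumr_ge0.
exists (\sum_(i < size s) X`_i), (B + 1)^-1; split; first by rewrite invr_gt0; lra.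
move=> v vB; rewrite {1}[v]coordX -big_split/=; apply: cone_sum => i.
rewrite -{1}[X`_i]scale1r -scalerDl; apply: coneZ => //.
have : `|coord X i v| <= 1.
  apply: le_trans (coordB v i) _; apply: (@le_trans _ _ ((B + 1)^-1 * B)).
    by rewrite ler_wpM2r.
  by rewrite ler_pdivrMl; lra.
by rewrite ler_norml => /andP[? _]; lra.
Qed.

(** The vector [u + (r / enorm x) *: x] still lies in the polar; pairing it with [x] itself gives
    the bound. *)
Lemma Omega_dotv_le u : Omega C u ->
  exists2 r, 0 < r & forall x, C x -> dotv x u <= - (r * enorm x).
Proof.
move=> [_ /interior_enorm[r r0 ur]]; exists r => // x Cx.
have [x0|x0] := eqVneq (enorm x) 0.
  by rewrite x0 mulr0 oppr0 (enorm_eq0 _ _ _ x0) dotv0l.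
have xp : 0 < enorm x by rewrite lt_neqAle eq_sym x0 enorm_ge0.
have /ur/(_ _ Cx) : enorm ((r / enorm x) *: x) <= r.
  by rewrite enormZ ger0_norm ?divfK// divr_ge0 ?enorm_ge0// ltW.
rewrite dotvDl dotvZl (dotvC _ _ u) -enorm_sq expr2 mulrA divfK//; lra.
Qed.

Lemma Omega_dotv_le0 u x : Omega C u -> C x -> dotv x u <= 0.
Proof.
move=> /Omega_dotv_le[r r0 /[apply]] /le_trans; apply.
by rewrite oppr_le0 mulr_ge0 ?enorm_ge0// ltW.
Qed.

Definition slab u t : set V := C `&` [set x | dotv x u <= - t].

Definition slab_face u t : set V := C `&` [set x | dotv x u = - t].

(** An interior point [q] of [C] satisfies [dotv q u < 0], because [q + r *: u] is still in [C]; so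
    a positive multiple of [q] lies on the hyperplane. *)
Lemma slab_face_interior_point u t : full_dim C -> Omega C u -> 0 < t ->
  exists p r, [/\ 0 < r, dotv p u = - t & forall v, enorm v <= r -> C (p + v)].
Proof.
move=> /full_dim_interior_point[q [r [r0 Cq]]] Ou t0; have [u1 _] := Ou.
have qu : dotv q u <= - r.
  have /Cq/(Omega_dotv_le0 _ _ Ou) : enorm (r *: u) <= r.
    by rewrite enormZ u1 mulr1 gtr0_norm.
  rewrite dotvDl dotvZl -enorm_sq u1; lra.
pose a := - t / dotv q u.
have a0 : 0 < a by rewrite /a mulNr -mulrN -invrN divr_gt0//; lra.
exists (a *: q), (a * r); split; first exact: mulr_gt0.
  by rewrite dotvZl /a divfK// lt_eqF//; lra.
move=> v va; have -> : a *: q + v = a *: (q + a^-1 *: v).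
  by rewrite scalerDr scalerA divff ?scale1r// gt_eqF.
apply: coneZ; first exact: ltW.
by apply: Cq; rewrite enormZ gtr0_norm ?invr_gt0// ler_pdivrMl.
Qed.

(** * The truncation as a pseudo-cone, its normals and its measures *)

Section Slab.
Variables (u : V) (t : R).
Hypotheses (dimC : full_dim C) (Ou : Omega C u) (t0 : 0 < t).
Local Notation K := (slab u t).
Local Notation F := (slab_face u t).

Lemma slab_face_sub : F `<=` K.
Proof. by move=> x [Cx xu]; split=> //; rewrite /= xu. Qed.

Lemma slab_face_neq0 : F !=set0.
Proof.
have [p [r [r0 pu Cp]]] := slab_face_interior_point _ _ dimC Ou t0.
by exists p; split=> //; rewrite -[p]addr0; apply: Cp; rewrite enorm0 ltW.
Qed.

Lemma slab_has_ubound w : Omega C w -> has_ubound [set dotv w y | y in K].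
Proof.
by move=> Ow; exists 0 => _ [y [Cy _] <-]; rewrite dotvC; exact: Omega_dotv_le0 Ow Cy.
Qed.

Lemma supp_slab : supp K u = - t.
Proof.
apply/eqP; rewrite eq_le; apply/andP; split.
  apply: ge_sup; last by move=> _ [y [_ yu] <-]; rewrite dotvC.
  by have [x Fx] := slab_face_neq0; exists (dotv u x), x => //; exact: slab_face_sub.
have [x Fx] := slab_face_neq0; apply: ub_le_sup; first exact: slab_has_ubound.
by exists x; [exact: slab_face_sub|rewrite dotvC; case: Fx].
Qed.

Lemma supp_bar_slab_ge0 w : Omega C w -> 0 <= supp_bar K w.
Proof.
move=> Ow; rewrite oppr_ge0; apply: ge_sup.
  by have [x Fx] := slab_face_neq0; exists (dotv w x), x => //; exact: slab_face_sub.
by move=> _ [y [Cy _] <-]; rewrite dotvC; exact: Omega_dotv_le0 Ow Cy.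
Qed.

Lemma slab_pseudo_cone : pseudo_cone K.
Proof.
have [clC C0 Cconv _] := coneC; split.
- by have [x /slab_face_sub Kx] := slab_face_neq0; exists x.
- have /continuous_closedP dotvu := dotv_continuous R n u.
  by apply: closedI => //; apply: (dotvu [set a | a <= - t]); exact: closed_le.
- move=> x y a [Cx /= xu] [Cy /= yu] /[dup] a01 /andP[a0 a1].
  split; first exact: Cconv.
  have a1' : 0 <= 1 - a by rewrite subr_ge0.
  by rewrite /= !dotvE; have := ler_wpM2l a1' xu; have := ler_wpM2l a0 yu; lra.
- by move=> [_ /=]; rewrite dotv0l oppr_ge0 leNgt t0.
- move=> x l [Cx /= xu] l1; split; first by apply: coneZ => //; lra.
  rewrite /= dotvZl (le_trans _ xu)// -[leRHS]mul1r ler_wnM2r//.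
  by rewrite (le_trans xu)// oppr_le0 ltW.
Qed.

(** If [z] is a recession direction, [z + y / k] lies in [C] for all positive [k]; since [C] is
    closed, a [z] outside [C] is excluded by taking [k] large. *)
Lemma recession_cone_slab : recession_cone K = C.
Proof.
have [clC _ _ _] := coneC.
apply/seteqP; split=> z; last first.
  move=> Cz y [Cy /= yu]; split; first exact: coneD.
  by rewrite /= dotvDl; have := Omega_dotv_le0 _ _ Ou Cz; lra.
move=> zK; apply: contrapT => /(closed_enorm _ _ _ _ clC)[r r0 zr].
have [y /slab_face_sub Ky] := slab_face_neq0.
have Kyz k : K (y + k%:R *: z).
  elim: k => [|k IH]; first by rewrite scale0r addr0.
  by rewrite -natr1 scalerDl scale1r addrA; exact: zK.
pose k := (Num.trunc (enorm y / r)).+1.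
have k0 : 0 < k%:R :> R by rewrite ltr0n.
apply: (zr (k%:R^-1 *: y)).
  rewrite enormZ gtr0_norm ?invr_gt0// ler_pdivrMl// -ler_pdivrMr//.
  by have /andP[_ /ltW] := truncn_itv (divr_ge0 (enorm_ge0 _ _ y) (ltW r0)).
have [Cyz _] := Kyz k.
have -> : z + k%:R^-1 *: y = k%:R^-1 *: (y + k%:R *: z).
  by rewrite scalerDr scalerA mulVf ?gt_eqF// scale1r addrC.
by apply: coneZ => //; rewrite invr_ge0 ltW.
Qed.

(** The halfspace at [u] alone already cuts [K] out of [C]; those at the other directions contain
    [K]. *)
Lemma slab_Kclass omega : omega `<=` Omega C -> omega u -> Kclass C omega K.
Proof.
move=> oO ou; split; first by split; [exact: slab_pseudo_cone|exact: recession_cone_slab].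
apply/seteqP; split=> x.
  move=> Kx; split; first by case: Kx.
  move=> w /oO Ow; rewrite /halfspace/= dotvC; apply: ub_le_sup; last by exists x.
  exact: slab_has_ubound.
by move=> [Cx /(_ u ou)]; rewrite /halfspace/= supp_slab.
Qed.

(* A normal in the interior of the polar is negative on C, so moving from x
   towards the apex would increase it: x must lie on the cutting hyperplane. *)
Lemma slab_Omega_normal x w : K x -> Omega C w -> outer_unit_normal K x w -> F x.
Proof.
have tp := t0; move=> [Cx /= xu] Ow [_ xw]; split=> //=; apply/eqP; rewrite eq_le xu leNgt.
apply/negP => xut; have xu0 : dotv x u < 0 by lra.
have : K ((- t / dotv x u) *: x).
  split; last by rewrite /= dotvZl divfK// lt_eqF.
  by apply: coneZ => //; rewrite mulNr -mulrN -invrN divr_ge0//; lra.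
move=> /xw; rewrite dotvZl; have [r r0 /(_ _ Cx) xr] := Omega_dotv_le _ Ow.
have x0 : 0 < enorm x.
  rewrite lt_neqAle enorm_ge0 andbT eq_sym; apply/eqP => /enorm_eq0 x0.
  by move: xu0; rewrite x0 dotv0l ltxx.
have xw0 : dotv x w < 0 by have := mulr_gt0 r0 x0; lra.
rewrite -[leRHS]mul1r ler_nM2r// mulNr -mulrN -invrN ler_pdivlMr; lra.
Qed.

Lemma slab_face_normal x : F x -> outer_unit_normal K x u.
Proof.
by move=> [Cx /= xu]; have [u1 _] := Ou; split=> // y [_ /=]; rewrite xu.
Qed.

Lemma slab_face_not_interior x : F x -> ~ interior K x.
Proof.
move=> [Cx /= xu] /interior_enorm[r r0 Kr].
have [u1 _] := Ou.
have [|_ /=] := Kr (r *: u); first by rewrite enormZ u1 mulr1 gtr0_norm.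
by rewrite dotvDl dotvZl -enorm_sq u1 xu; lra.
Qed.

Lemma rev_gauss_map_slab (eta : set V) : eta `<=` Omega C -> eta u ->
  rev_gauss_map K eta = F.
Proof.
move=> eO eu; apply/seteqP; split=> x.
  by move=> [Kx [_ [w /eO Ow]]]; exact: slab_Omega_normal.
move=> Fx; split; first exact: slab_face_sub.
split; first exact: slab_face_not_interior.
by exists u => //; exact: slab_face_normal.
Qed.

Lemma slab_face_bounded : exists M, forall x, F x -> enorm x <= M.
Proof.
have [r r0 Cr] := Omega_dotv_le _ Ou; exists (t / r) => x [/Cr xr /= xu].
by rewrite ler_pdivlMr// mulrC; lra.
Qed.

Lemma hausdorff_slab_face_fin : (hausdorff n.-1 F < +oo)%E.
Proof.
have [M FM] := slab_face_bounded; have [u1 _] := Ou.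
have u0 : u != 0.
  by apply/eqP => u0; move: u1; rewrite u0 enorm0 => /eqP; rewrite eq_sym oner_eq0.
by apply: (hausdorff_bounded_slice _ _ _ u (- t) M) => // x [].
Qed.

Lemma hausdorff_rev_gauss_map_slab_eq0 (eta E : set V) : eta `<=` Omega C -> ~ eta u ->
  E `<=` rev_gauss_map K eta -> hausdorff n.-1 E = 0%E.
Proof.
have tp := t0; move=> eO neu EK; have [u1 _] := Ou.
have [p [r [r0 pu Cp]]] := slab_face_interior_point _ _ dimC Ou t0.
have Fp : F p by split=> //; rewrite -[p]addr0; apply: Cp; rewrite enorm0 ltW.
have [Cp0 _] := Fp; have [_ _ Cconv _] := coneC.
have EF : E `<=` F.
  by move=> x /EK[Kx [_ [w /eO Ow]]]; exact: slab_Omega_normal.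
apply: (hausdorff_rel_boundary_eq0 _ _ _ F E p r) => //.
- move=> x c [Cx /= xu] /andP[c0 c1]; split; last by rewrite /= !dotvE xu pu; ring.
  by apply: coneD; apply: coneZ => //; lra.
- exact: hausdorff_slab_face_fin.
move=> x Ex; have [Kx [_ [w ew [w1 xw]]]] := EK _ Ex.
have Ow := eO _ ew; have [_ /= xu] := EF _ Ex.
(* The extremal direction inside the face is the component of [w] orthogonal to [u], normalised. *)
pose a := dotv w u; pose z := w - a *: u; pose b := enorm z.
have uu : dotv u u = 1 by rewrite -enorm_sq u1 expr1n.
have ww : dotv w w = 1 by rewrite -enorm_sq w1 expr1n.
have zu : dotv z u = 0 by rewrite /z !dotvE uu -/a; ring.
have zw : dotv z w = b ^+ 2.
  rewrite /b enorm_sq /z !dotvE uu ww (dotvC _ _ u w) -/a; ring.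
(* Otherwise [w] is [u], which is not in [eta], or [- u], which is positive at [p] although [w] is
   in [Omega C]. *)
have b0 : 0 < b.
  rewrite lt_neqAle enorm_ge0 andbT eq_sym; apply/eqP => /enorm_eq0 z0.
  have wa : w = a *: u by apply/eqP; rewrite -subr_eq0 -/z z0.
  have : a ^+ 2 = 1 by rewrite -ww wa dotvE dotvZr uu; ring.
  move=> /eqP; rewrite sqrf_eq1 => /orP[] /eqP aE.
    by apply: neu; rewrite aE scale1r in wa; rewrite -wa.
  by have := Omega_dotv_le0 _ _ Ow Cp0; rewrite wa aE dotvZr pu; lra.
have Fdot y : F y -> dotv (y - p) (b^-1 *: z) = b^-1 * dotv (y - p) w.
  move=> [_ /= yu]; have yp : dotv (y - p) u = 0 by rewrite dotvDl dotvNl yu pu subrr.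
  by rewrite dotvZr /z dotvDr dotvNr dotvZr yp mulr0 subr0.
have bz : enorm (b^-1 *: z) = 1 by rewrite enormZ gtr0_norm ?invr_gt0// mulVf// gt_eqF.
exists (b^-1 *: z); split=> //.
  move=> y Fy; rewrite !Fdot ?EF//; last exact: EF.
  rewrite ler_wpM2l ?invr_ge0 ?(ltW b0)// !dotvDl lerD2r.
  by apply: xw; exact: slab_face_sub.
rewrite Fdot; last exact: EF.
rewrite ler_pdivlMl//.
(* This point of the ball around [p] stays on the hyperplane; comparing it with [x] through the
   normal [w] yields the margin [r]. *)
have : K (p + r *: (b^-1 *: z)).
  split; first by apply: Cp; rewrite enormZ bz mulr1 gtr0_norm.
  by rewrite /= dotvDl !dotvZl zu pu !mulr0 addr0.
move=> /xw; rewrite !dotvDl !dotvZl zw dotvNl.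
have -> : r * (b^-1 * b ^+ 2) = b * r by field; rewrite gt_eqF.
lra.
Qed.

(** * The cone measure as an atom at [u] *)

Definition slab_mass : \bar R :=
  nonneg_integral (hausdorff n.-1) F (@gauss_density R n).

Lemma S_gauss_slab_in eta : eta `<=` Omega C -> eta u -> S_gauss K eta = slab_mass.
Proof. by move=> eO eu; rewrite /S_gauss rev_gauss_map_slab. Qed.

Lemma S_gauss_slab_notin eta : eta `<=` Omega C -> ~ eta u -> S_gauss K eta = 0%E.
Proof.
move=> eO eu; apply: nonneg_integral_null => E.
exact: hausdorff_rev_gauss_map_slab_eq0 eO eu.
Qed.

(** In a lower sum at most one piece contains [u], and only that piece has nonzero measure; its
    infimum is at most [supp_bar K u = t]. The single piece [[set u]] attains the bound. *)
Lemma C_gauss_slab_in eta : eta `<=` Omega C -> eta u ->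
  C_gauss K eta = (t%:E * slab_mass)%E.
Proof.
move=> eO eu; have mass0 : (0 <= slab_mass)%E by exact: nonneg_integral_ge0.
have tm0 : (0 <= t%:E * slab_mass)%E by rewrite mule_ge0// lee_fin ltW.
have suppt : supp_bar K u = t by rewrite /supp_bar supp_slab opprK.
apply/eqP; rewrite eq_le; apply/andP; split.
  apply: ge_ereal_sup => _ [k [E [_ Eeta dE ->]]].
  have Eout (i : 'I_k) : ~ E i u ->
      ((inf [set supp_bar K x | x in E i])%:E * S_gauss K (E i) = 0)%E.
    move=> nEu; rewrite S_gauss_slab_notin ?mule0//.
    exact: subset_trans (Eeta i) eO.
  have [[i Eiu]|noE] := pselect (exists i : 'I_k, E i u); last first.
    by rewrite big1// => i _; apply: Eout => Eiu; apply: noE; exists i.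
  rewrite (bigD1 i)//= big1 ?adde0; last first.
    move=> j ji; apply: Eout => Eju.
    have : (E j `&` E i) u by [].
    by rewrite dE// => /val_inj/eqP; rewrite (negbTE ji).
  have EO : E i `<=` Omega C by exact: subset_trans (Eeta i) eO.
  rewrite S_gauss_slab_in// lee_wpmul2r// lee_fin -[leRHS]suppt.
  by apply: inf_image_le => // x /EO; exact: supp_bar_slab_ge0.
apply: ereal_sup_ubound; exists 1%N, (fun=> [set u]); split.
- by move=> _; exact: Borel_set1.
- by move=> _ x ->.
- by move=> [|i] [|j].
- rewrite big_ord_recl big_ord0 adde0 image_set1 inf1 suppt.
  by rewrite S_gauss_slab_in// => x ->.
Qed.

Lemma C_gauss_slab_notin eta : eta `<=` Omega C -> ~ eta u -> C_gauss K eta = 0%E.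
Proof.
move=> eO eu; apply: nonneg_integral_null => E Eeta.
by apply: S_gauss_slab_notin; [exact: subset_trans eO|move=> /Eeta].
Qed.

End Slab.

End Cone.

(** * Two truncations of equal mass *)

Section EqualMass.
Variables (R : realType) (n : nat) (C : set 'rV[R]_n) (u : 'rV[R]_n).
Implicit Types (x : 'rV[R]_n) (t s : R).
Local Notation mass := (slab_mass R n C u).

(** The Gaussian mass of the face at level [t], carried to the fixed face at level 1 and stripped of
    the power of [t] from the change of variables. *)
Definition scaled_mass t : \bar R :=
  nonneg_integral (hausdorff n.-1) (slab_face R n C u 1)
    (fun x => gauss_density (t *: x)).

Lemma gauss_density_ge0 x : 0 <= gauss_density x.
Proof. by rewrite mulr_ge0 ?expR_ge0// invr_ge0 exprn_ge0. Qed.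

Lemma gauss_density_scale t s x : gauss_density (s *: x) =
  expR (- ((s ^+ 2 - t ^+ 2) * (enorm x ^+ 2 / 2))) * gauss_density (t *: x).
Proof.
rewrite /gauss_density mulrCA -expRD !enormZ !exprMn !real_normK ?num_real//.
by congr (_ * expR _); field.
Qed.

Hypotheses (coneC : closed_convex_cone C) (Ou : Omega C u).

Lemma slab_mass_scale t : 0 < t -> (0 < n)%N ->
  (t%:E * mass t = (t ^+ n)%:E * scaled_mass t)%E.
Proof.
(* One factor [t] is the support value; the other [n.-1] come from scaling the Hausdorff measure. *)
move=> t0 n0; have -> : t ^+ n = t * t ^+ n.-1 by rewrite -exprS prednK.
rewrite EFinM -muleA; congr (_ * _)%E; apply: nonneg_integral_hausdorff_scale => //.
- move=> x [Cx /= xu]; split; first by apply: (coneZ _ _ _ coneC) => //; rewrite invr_ge0 ltW.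
  by rewrite /= dotvZl xu mulrN mulVf// gt_eqF.
- move=> x [Cx /= xu]; split; first by apply: (coneZ _ _ _ coneC) => //; rewrite ltW.
  by rewrite /= dotvZl xu mulrN1.
- exact: gauss_density_ge0.
Qed.

(** On the face at level 1, [dotv x u = - 1] with [u] a unit vector, so [1 <= enorm x] and the
    density decays at least at this rate. The converse estimate below uses boundedness of the
    face. *)
Lemma scaled_mass_le t s : 0 < t -> t <= s ->
  (scaled_mass s <= (expR (- ((s ^+ 2 - t ^+ 2) / 2)))%:E * scaled_mass t)%E.
Proof.
move=> t0 ts; apply: le_nonneg_integral => [E||x _|x [_ /= xu]].
- exact: hausdorff_ge0.
- exact: expR_gt0.
- exact: gauss_density_ge0.
have x1 : 1 <= enorm x.
  rewrite -(opprK 1) -xu -dotvNl -enormN; apply: dotv_le_enorm.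
  by case: Ou.
rewrite (gauss_density_scale t s) ler_wpM2r ?gauss_density_ge0// ler_expR lerN2.
have ts0 : 0 <= s ^+ 2 - t ^+ 2 by nra.
by rewrite ler_wpM2l// ler_pdivlMr// mulVf// exprn_ege1.
Qed.

Lemma scaled_mass_ge : exists2 M, 0 <= M & forall t s, 0 < t -> t <= s ->
  (scaled_mass t <= (expR ((s ^+ 2 - t ^+ 2) * M))%:E * scaled_mass s)%E.
Proof.
have [M FM] := slab_face_bounded _ _ _ u 1 Ou; exists (M ^+ 2 / 2).
  by rewrite divr_ge0 ?sqr_ge0.
move=> t s t0 ts; apply: le_nonneg_integral => [E||x _|x /FM xM].
- exact: hausdorff_ge0.
- exact: expR_gt0.
- exact: gauss_density_ge0.
rewrite (gauss_density_scale t s) mulrA -expRD.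
rewrite -[leLHS]mul1r ler_wpM2r ?gauss_density_ge0// -[leLHS]expR0 ler_expR.
rewrite -mulrBr mulr_ge0//; first by nra.
rewrite subr_ge0 ler_wpM2r// lerXn2r ?nnegrE ?enorm_ge0//.
exact: le_trans (enorm_ge0 _ _ x) xM.
Qed.

Lemma exists_equal_slab_mass : (0 < n)%N ->
  exists t s, [/\ 0 < t, t < s & (t%:E * mass t = s%:E * mass s)%E].
Proof.
move=> n0; have [M M0 Mge] := scaled_mass_ge.
have I0 t : (0 <= scaled_mass t)%E by exact: nonneg_integral_ge0.
have [t [s [t0 ts E]]] :=
  exists_equal_values_ereal R scaled_mass n M n0 M0 I0 scaled_mass_le Mge.
exists t, s; split; [exact: t0|exact: ts|].
by rewrite (slab_mass_scale t t0 n0) (slab_mass_scale s (lt_trans t0 ts) n0).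
Qed.

End EqualMass.

Theorem theorem7p4 (R : realType) (n : nat) (C omega : set 'rV[R]_n) :
  closed_convex_cone C -> pointed C -> full_dim C ->
  omega `<=` Omega C -> omega !=set0 -> compact omega ->
  exists K L : set 'rV[R]_n,
    [/\ Kclass C omega K, Kclass C omega L,
        (forall eta, Borel eta -> eta `<=` Omega C -> C_gauss K eta = C_gauss L eta)
      & K <> L].
Proof.
move=> coneC _ dimC oO [u ou] _; have Ou := oO _ ou.
(* In dimension 0 there is no unit vector [u]. *)
have n0 : (0 < n)%N.
  case: n C omega u coneC dimC oO ou Ou => // D E v _ _ _ _ [v1 _].
  by move: v1; rewrite /enorm /dotv big_ord0 sqrtr0 => /eqP; rewrite eq_sym oner_eq0.
have [t [s [t0 ts mass_ts]]] := exists_equal_slab_mass R n C u coneC Ou n0.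
have s0 : 0 < s by exact: lt_trans ts.
exists (slab R n C u t), (slab R n C u s); split.
- exact: slab_Kclass.
- exact: slab_Kclass.
- move=> eta _ eO; have [eu|neu] := pselect (eta u).
    by rewrite !C_gauss_slab_in.
  by rewrite !C_gauss_slab_notin.
(* A point of the face at level [t] has [dotv x u = - t > - s], so it is outside the deeper
   truncation. *)
move=> tsE; have [x Fx] := slab_face_neq0 _ _ _ coneC u t dimC Ou t0.
have : slab R n C u s x by rewrite -tsE; exact: slab_face_sub Fx.
by move=> [_ /=]; case: Fx => _ /= ->; rewrite lerN2 leNgt ts.
Qed.
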